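(* There exists a Banach space $X$ such that: (a) $X$ is (linearly) isomorphic to $\ell_1$; (b) $X$ has a strongly unique predual; and (c) $X$ has a weak$^*$ closed, $1$-complemented subspace of codimension $1$ that is linearly isometric to $\ell_1$.
   Context: All Banach spaces are real. A dual Banach space is a Banach space that is linearly isometric to the dual $Y^*$ of some Banach space $Y$ (a predual). A dual Banach space $X$ has a strongly unique predual if there is, up to linear isometry, a unique Banach space $Y$ with $Y^*$ linearly isometric to $X$ and moreover every surjective linear isometry $T:X\to Z^*$ onto the dual of a Banach space $Z$ is weak$^*$-to-weak$^*$ continuous (so that the weak$^*$ topology of $X$ does not depend on the choice of predual). In (c), weak$^*$ closed refers to this weak$^*$ topology of $X$. A closed subspace $V\subset X$ is $1$-complemented if there is a bounded linear projection of norm $1$ from $X$ onto $V$. *)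

(* Defs.v *)
From HB Require Import structures.
From mathcomp Require Import all_boot all_order all_algebra.
From mathcomp Require Import mathcomp_extra boolp classical_sets functions.
From mathcomp Require Import reals topology normedtype sequences landau.

Set Implicit Arguments.
Unset Strict Implicit.
Unset Printing Implicit Defensive.

Import Order.TTheory GRing.Theory Num.Theory.
Import numFieldNormedType.Exports.

Local Open Scope classical_set_scope.
Local Open Scope ring_scope.

Section BoundedOp.
Context {R : realType} {V W : normedModType R}.

Definition is_bounded_op : {pred V -> W} :=
  [pred f | `[< linear f /\ continuous f >]].

Record boundedOp := BoundedOp {
  boundedOp_fun :> V -> W;
  boundedOpP : boundedOp_fun \in is_bounded_op }.

HB.instance Definition _ := [isSub for boundedOp_fun].
HB.instance Definition _ := [Choice of boundedOp by <:].

Lemma is_bounded_op_submod_closed : submod_closed is_bounded_op.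
Proof.
split=> [|a f g]; rewrite !inE.
  split=> [b x y|]; last exact: cst_continuous.
  by have E z : (0 : V -> W) z = 0 by []; rewrite !E scaler0 addr0.
move=> [lf cf] [lg cg]; split=> [b x y|x].
  have E z : (a *: f + g) z = a *: f z + g z by [].
  by rewrite !E lf lg !scalerDr !scalerA addrACA (mulrC a).
apply: (@continuousD _ _ _ (a *: f) g); last exact: cg.
by apply: continuousZr; exact: cf.
Qed.

HB.instance Definition _ := GRing.isSubmodClosed.Build _ _ is_bounded_op
  is_bounded_op_submod_closed.
HB.instance Definition _ := [SubChoice_isSubLmodule of boundedOp by <:].

Implicit Types f g : boundedOp.

Lemma boundedOp_linear f : linear f.
Proof. by have := boundedOpP f; rewrite inE => -[]. Qed.

Lemma boundedOp_continuous f : continuous f.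
Proof. by have := boundedOpP f; rewrite inE => -[]. Qed.

HB.instance Definition _ f :=
  GRing.isLinear.Build R V W *:%R f (boundedOp_linear f).

Definition opnorm f : R := sup [set `|f x| | x in [set x : V | `|x| <= 1]].

Lemma has_sup_opnorm f :
  has_sup [set `|f x| | x in [set x : V | `|x| <= 1]].
Proof.
split; first by exists `|f 0|; exists 0 => //=; rewrite normr0.
have /linear_bounded_continuous/bounded_funP/(_ 1)[M fM] :=
  @boundedOp_continuous f.
by exists M => _ [x x1 <-]; exact: fM.
Qed.

Lemma opnorm_unit_ball f x : `|x| <= 1 -> `|f x| <= opnorm f.
Proof.
by move=> x1; apply: ub_le_sup; [exact: (has_sup_opnorm f).2 | exists x].
Qed.

Lemma opnorm_le f M : (forall x, `|x| <= 1 -> `|f x| <= M) -> opnorm f <= M.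
Proof.
move=> fM; apply: ge_sup; first exact: (has_sup_opnorm f).1.
by move=> _ [x x1 <-]; exact: fM.
Qed.

Lemma opnorm_ge0 f : 0 <= opnorm f.
Proof. by rewrite (le_trans _ (@opnorm_unit_ball f 0 _)) ?normr0. Qed.

Lemma opnorm_ub f x : `|f x| <= opnorm f * `|x|.
Proof.
have [->|x0] := eqVneq x 0; first by rewrite linear0 !normr0 mulr0.
have nx0 : 0 < `|x| by rewrite normr_gt0.
have := @opnorm_unit_ball f (`|x|^-1 *: x).
rewrite linearZ !normrZ normfV normr_id mulVf ?gt_eqF// => /(_ (lexx _)).
by rewrite mulrC ler_pdivrMr.
Qed.

Lemma ler_opnormD f g : opnorm (f + g) <= opnorm f + opnorm g.
Proof.
apply: opnorm_le => x x1; rewrite (le_trans (ler_normD _ _))//.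
by rewrite lerD ?opnorm_unit_ball.
Qed.

Lemma opnormZ (l : R) f : opnorm (l *: f) = `|l| * opnorm f.
Proof.
apply/eqP; rewrite eq_le; apply/andP; split.
  apply: opnorm_le => x x1; rewrite normrZ.
  by rewrite ler_wpM2l ?opnorm_unit_ball.
have [->|l0] := eqVneq l 0; first by rewrite normr0 mul0r opnorm_ge0.
rewrite mulrC -ler_pdivlMr ?normr_gt0//; apply: opnorm_le => x x1.
rewrite ler_pdivlMr ?normr_gt0// mulrC -normrZ.
exact: (@opnorm_unit_ball (l *: f)).
Qed.

Lemma opnorm_eq0 f : opnorm f = 0 -> f = 0.
Proof.
move=> f0; apply/val_inj/funext => x; apply/eqP; rewrite -normr_le0.
by have := opnorm_ub f x; rewrite f0 mul0r.
Qed.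

HB.instance Definition _ := Lmodule_isNormed.Build R boundedOp
  ler_opnormD opnormZ opnorm_eq0.

End BoundedOp.
Arguments boundedOp {R} V W.

Definition dual (R : realType) (Y : normedModType R) := boundedOp Y R^o.

Section Ell1.
Context (R : realType).

Definition is_ell1 : {pred nat -> R} :=
  [pred u : nat -> R | `[< cvgn (series (fun n => `|u n|)) >]].

Record ell1 := Ell1 { ell1_seq :> nat -> R; ell1P : ell1_seq \in is_ell1 }.

HB.instance Definition _ := [isSub for ell1_seq].
HB.instance Definition _ := [Choice of ell1 by <:].

Lemma is_ell1_submod_closed :
  submod_closed (is_ell1 : {pred nat -> R^o}).
Proof.
split=> [|a u v]; rewrite !inE.
  rewrite (_ : series _ = cst 0); first exact: is_cvg_cst.
  by apply/funext => n; rewrite /series/= big1// => i _; rewrite normr0.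
move=> cu cv.
apply: (@series_le_cvg _ _ (`|a| *: (fun n => `|u n|) + (fun n => `|v n|))).
- by move=> n; rewrite /= normr_ge0.
- by move=> n; rewrite /= addr_ge0 ?mulr_ge0.
- by move=> n; rewrite /= (le_trans (ler_normD _ _))// normrM.
- by apply: is_cvg_seriesD => //; exact: is_cvg_seriesZ.
Qed.

HB.instance Definition _ := GRing.isSubmodClosed.Build R (nat -> R^o) is_ell1
  is_ell1_submod_closed.
HB.instance Definition _ := [SubChoice_isSubLmodule of ell1 by <:].

Implicit Types u v : ell1.

Definition ell1_norm u : R := limn (series (fun n => `|u n|)).

Lemma ell1_cvg u : cvgn (series (fun n => `|u n|)).
Proof. by have := ell1P u; rewrite inE. Qed.

Lemma ler_ell1_normD u v : ell1_norm (u + v) <= ell1_norm u + ell1_norm v.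
Proof.
rewrite /ell1_norm -(lim_seriesD (@ell1_cvg u) (@ell1_cvg v)).
apply: lim_series_le; [exact: ell1_cvg| |by move=> n; exact: ler_normD].
by apply: is_cvg_seriesD; exact: ell1_cvg.
Qed.

Lemma ell1_normZ (l : R) u : ell1_norm (l *: u) = `|l| * ell1_norm u.
Proof.
rewrite /ell1_norm -[RHS](lim_seriesZ _ (@ell1_cvg u)); congr (limn (series _)).
by apply/funext => n; exact: normrM.
Qed.

Lemma ell1_norm_eq0 u : ell1_norm u = 0 -> u = 0.
Proof.
move=> u0; apply/val_inj/funext => n; apply/eqP; rewrite -normr_le0 -u0.
apply: le_trans (nondecreasing_cvgn_le _ (@ell1_cvg u) n.+1).
  by rewrite /series/= big_nat_recr//= lerDr sumr_ge0.
by apply/nondecreasing_seqP => k; rewrite /series/= big_nat_recr//= lerDl.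
Qed.

HB.instance Definition _ := Lmodule_isNormed.Build R ell1
  ler_ell1_normD ell1_normZ ell1_norm_eq0.

End Ell1.

Definition linearly_isomorphic (R : realType) (V W : normedModType R) :=
  exists (T : boundedOp V W) (S : boundedOp W V), cancel T S /\ cancel S T.

Definition linear_isometry (R : realType) (V W : normedModType R)
  (T : V -> W) := linear T /\ forall x, `|T x| = `|x|.

Definition surjective_linear_isometry (R : realType) (V W : normedModType R)
  (T : V -> W) := linear_isometry T /\ range T = setT.

Definition linearly_isometric (R : realType) (V W : normedModType R) :=
  exists T : V -> W, surjective_linear_isometry T.

(* The subspace A carries the norm of W. *)
Definition subspace_linearly_isometric (R : realType) (W V : normedModType R)
  (A : set W) := exists T : V -> W, linear_isometry T /\ range T = A.

(* X with the weak* topology transported from the dual of Y along J: the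
   coarsest topology making x |-> J x y continuous for every y in Y. For
   J = idfun this is the weak* topology of the dual of Y. *)
Definition weak_star (R : realType) (X Y : normedModType R)
    (J : X -> dual Y) : topologicalType :=
  initial_topology (fun x : X => (J x : Y -> R^o) : {ptws Y -> R^o}).

Definition strongly_unique_predual (R : realType)
    (X Y : completeNormedModType R) (J : X -> dual Y) :=
  [/\ surjective_linear_isometry J,
      forall Z : completeNormedModType R,
        linearly_isometric X (dual Z) -> linearly_isometric Y Z
    & forall (Z : completeNormedModType R) (T : X -> dual Z),
        surjective_linear_isometry T ->
        continuous (T : weak_star J -> weak_star (@idfun (dual Z)))].

(* b induces a basis of the quotient of X by A. *)
Definition has_codim (R : realType) (X : normedModType R) (A : set X)
    (n : nat) :=
  exists b : 'I_n -> X, forall x : X,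
    exists! a : 'rV[R]_n, A (x - \sum_(i < n) a ord0 i *: b i).

Definition one_complemented (R : realType) (X : normedModType R)
    (A : set X) :=
  exists P : boundedOp X X,
    [/\ forall x, P (P x) = P x, range P = A & `|P| = 1].

(* Main.v *)
Require Import Defs.
From HB Require Import structures.
From mathcomp Require Import all_boot all_order all_algebra.
From mathcomp Require Import boolp classical_sets functions reals topology.
From mathcomp Require Import normedtype sequences lra.

Set Implicit Arguments.
Unset Strict Implicit.
Unset Printing Implicit Defensive.

Import Order.TTheory GRing.Theory Num.Theory.
Import numFieldNormedType.Exports.

Local Open Scope classical_set_scope.
Local Open Scope ring_scope.

(** Give the sequences u = (u_0, u_1, ...) of ell1 the norm
      |u| = max (sum_(n >= 1) |u_n|, |u_0| + sup_(n >= 1) |u_n|)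
    and call X the resulting space ([renormed]).  It lies between half of the
    ell1 norm and the ell1 norm, so X is isomorphic to ell1.  On the hyperplane
    u_0 = 0 it equals the sum of the |u_n|, and replacing u_0 by 0 does not
    increase it, so this hyperplane is a 1-complemented isometric copy of ell1.

    Let e_n be the unit vectors and let Y ([predual]) be the closed space of
    the functionals f on X with f e_n --> 0.  Both quantities in the norm are
    suprema of finite combinations of coordinates, which belong to Y, and these
    combinations are dense in Y; hence evaluation identifies X with the dual of
    Y ([duality_surjective_isometry]), and the hyperplane is weak* closed.

    Uniqueness rests on the fact that a closed ball of X is weak* compact for
    whatever predual Z induces the weak* topology.  For distinct k, n >= 1,
    every choice of signs gives
      |e_n +- e_0 +- e_k| <= 2.
    A weak* cluster point x of (e_n) must satisfy |x +- e_0 +- e_k| <= 2 as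
    well; with the signs of x_0 and x_k this gives
    (|x_0| + 1) + (|x_k| + 1) <= 2, so x = 0 ([unit_vec_separated]).  Thus e_n
    is weak* null for every predual ([weak_star_null]), which means that each z
    in Z, seen as a functional on X, lies in Y ([slice]).  By Hahn-Banach this embedding of Z in Y is
    isometric ([slice_isometry]); its closed range is annihilated by no nonzero
    element of X = Y*, so it is all of Y ([slice_surjective]).  Both the
    isometry between Y and Z and the weak* continuity follow.  The coordinate
    u_0 is what breaks the symmetry of ell1, in whose own preduals (such as the
    space of convergent sequences) the unit vectors may have a nonzero weak*
    limit. *)

(** * Bounded operators into a complete space *)

Section BoundedOpConstruction.
Context {R : realType} {V W : normedModType R}.

Lemma linear_le_continuous (f : V -> W) (M : R) :
  linear f -> (forall x, `|f x| <= M * `|x|) -> continuous f.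
Proof.
move=> lf fM.
pose g : {linear V -> W} := HB.pack f (GRing.isLinear.Build R V W *:%R f lf).
apply/(@linear_bounded_continuous _ _ _ g)/bounded_funP => r.
exists (`|M| * r) => x xr; rewrite (le_trans (fM x))//.
by rewrite (le_trans (ler_norm _))// normrM normr_id ler_wpM2l.
Qed.

Lemma bounded_op_of_proof (f : V -> W) (M : R) :
  linear f -> (forall x, `|f x| <= M * `|x|) -> f \in @is_bounded_op R V W.
Proof.
by move=> lf fM; rewrite inE; split => //; exact: linear_le_continuous fM.
Qed.

Definition bounded_op_of (f : V -> W) (M : R) (lf : linear f)
    (fM : forall x, `|f x| <= M * `|x|) : boundedOp V W :=
  BoundedOp (bounded_op_of_proof lf fM).

Lemma opnorm_le_mul (f : boundedOp V W) (M : R) :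
  0 <= M -> (forall x, `|f x| <= M * `|x|) -> `|f| <= M.
Proof.
move=> M0 fM; apply: opnorm_le => x x1.
by rewrite (le_trans (fM x))// -[leRHS]mulr1 ler_wpM2l.
Qed.

Lemma boundedOp_ub (f : boundedOp V W) x : `|f x| <= `|f| * `|x|.
Proof. exact: opnorm_ub. Qed.

Lemma boundedOp_add (f g : boundedOp V W) x : (f + g) x = f x + g x.
Proof. by []. Qed.

Lemma boundedOp_opp (f : boundedOp V W) x : (- f) x = - f x.
Proof. by []. Qed.

Lemma boundedOp_eq (f g : boundedOp V W) : f =1 g -> f = g.
Proof. by move=> fg; apply/val_inj/funext. Qed.

End BoundedOpConstruction.

Section BoundedOpComplete.
Context {R : realType} {V : normedModType R} {W : completeNormedModType R}.

(** A Cauchy filter of operators converges pointwise; the operator norm distance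
    to the pointwise limit is controlled because the Cauchy estimate at a fixed
    operator passes to the limit at each point. *)
Lemma boundedOp_complete (F : set_system (boundedOp V W)) :
  ProperFilter F -> cauchy F -> cvg F.
Proof.
move=> FF cF.
have cF' e : 0 < e -> exists f, F (ball f e).
  by move=> e0; move: cF => /cauchyP /(_ e e0).
have cvx x : cvg ((fun f : boundedOp V W => f x) @ F).
  apply/cauchy_cvgP/cauchyP => e e0.
  have x0 : 0 < `|x| + 1 by rewrite ltr_wpDl.
  have [f Ff] := cF' (e / (`|x| + 1)) (divr_gt0 e0 x0).
  exists (f x); suff : F [set g : boundedOp V W | ball (f x) e (g x)] by [].
  apply: filterS Ff => g.
  rewrite -!ball_normE /ball_ /= => fg.
  have -> : f x - g x = (f - g) x by [].
  rewrite (le_lt_trans (boundedOp_ub _ _))//.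
  move: fg; rewrite ltr_pdivlMr// => fg; rewrite (le_lt_trans _ fg)//.
  by rewrite ler_wpM2l// lerDl.
pose g x : W := lim ((fun f : boundedOp V W => f x) @ F).
have gE x : (fun f : boundedOp V W => f x) @ F --> g x by exact: cvx.
have lg : linear g.
  move=> a x y; rewrite {1}/g; apply: cvg_lim; first exact: norm_hausdorff.
  rewrite (_ : (fun f : boundedOp V W => f _) =
    (fun f : boundedOp V W => a *: f x + f y)).
    by apply: cvgD; [apply: cvgZ; [exact: cvg_cst|exact: gE]|exact: gE].
  by apply/funext => f; rewrite linearP.
have close f e : F (ball f e) -> forall x, `|f x - g x| <= e * `|x|.
  move=> Ffe x.
  have h : (fun h : boundedOp V W => `|f x - h x|) @ F --> `|f x - g x|.
    by apply: cvg_norm; apply: cvgB; [exact: cvg_cst|exact: gE].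
  have -> : `|f x - g x| = lim ((fun h : boundedOp V W => `|f x - h x|) @ F).
    by apply/esym/cvg_lim => //; exact: norm_hausdorff.
  apply: limr_le; first by apply/cvg_ex; exists `|f x - g x|.
  apply: filterS Ffe => k; rewrite -ball_normE /= => fk.
  have -> : f x - k x = (f - k) x by [].
  by rewrite (le_trans (boundedOp_ub _ _))// ler_wpM2r// ltW.
have [f1 Ff1] := cF' 1 ltr01.
have gM x : `|g x| <= (`|f1| + 1) * `|x|.
  have -> : g x = f1 x - (f1 x - g x) by rewrite opprB addrC subrK.
  rewrite (le_trans (ler_normB _ _))// mulrDl lerD ?boundedOp_ub//.
  exact: close.
pose G := bounded_op_of lg gM.
apply/cvg_ex; exists G; apply/cvgrPdist_le => e e0.
have e20 : 0 < e / 2 by rewrite divr_gt0.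
have [f Ff] := cF' _ e20.
apply: filterS (Ff) => k; rewrite -ball_normE /= => fk.
have -> : G - k = (G - f) + (f - k) by rewrite addrA subrK.
rewrite (le_trans (ler_normD _ _))// (splitr e) lerD//.
- apply: opnorm_le_mul; first exact: ltW.
  by move=> x; rewrite boundedOp_add boundedOp_opp distrC; exact: close.
- exact/ltW/fk.
Qed.

HB.instance Definition _ :=
  Uniform_isComplete.Build (boundedOp V W) boundedOp_complete.

End BoundedOpComplete.

(** * The Hahn-Banach theorem *)

Definition sublinear (R : realType) (V : lmodType R) (p : V -> R) :=
  (forall x y, p (x + y) <= p x + p y) /\
  (forall a x, 0 <= a -> p (a *: x) = a * p x).

Section HahnBanach.
Context {R : realType} {V : lmodType R} (p : V -> R).
Context (p_sublinear : sublinear p).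

Let pD x y : p (x + y) <= p x + p y.
Proof. by have [+ _] := p_sublinear; apply. Qed.

Let pZ a x : 0 <= a -> p (a *: x) = a * p x.
Proof. by have [_ +] := p_sublinear; apply. Qed.

Let p0 : p 0 = 0.
Proof. by rewrite -(scale0r (0 : V)) pZ// mul0r. Qed.

(** Partial linear functionals below [p] are encoded by their graphs, so that
    Zorn's lemma applies to sets under inclusion.  Single-valuedness is a
    consequence of the domination ([dominated_graph_inj]).  The empty set
    qualifies, as the union of the empty chain must. *)
Definition dominated_graph (G : set (V * R)) :=
  (forall a x y r s, G (x, r) -> G (y, s) -> G (a *: x + y, a * r + s)) /\
  (forall x r, G (x, r) -> r <= p x).

Lemma dominated_graph_line x0 :
  dominated_graph [set u | exists t, u = (t *: x0, t * p x0)].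
Proof.
split=> [a _ _ _ _ [t [-> ->]] [s [-> ->]]|_ _ [t [-> ->]]].
  by exists (a * t + s); rewrite scalerDl mulrDl scalerA mulrA.
have [t0|t0] := leP 0 t; first by rewrite pZ.
have := pD (t *: x0) (- t *: x0).
rewrite -scalerDl subrr scale0r p0 (pZ (a := - t)) ?oppr_ge0 ?(ltW t0)//.
by rewrite mulNr subr_ge0.
Qed.

Lemma dominated_graph0 G x r : dominated_graph G -> G (x, r) -> G (0, 0).
Proof.
move=> [GL _] Gx; have := GL (-1) _ _ _ _ Gx Gx.
by rewrite scaleN1r addNr mulN1r addNr.
Qed.

Lemma dominated_graphZ G a x r :
  dominated_graph G -> G (x, r) -> G (a *: x, a * r).
Proof.
move=> PG Gx; have := PG.1 a _ _ _ _ Gx (dominated_graph0 PG Gx).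
by rewrite !addr0.
Qed.

Lemma dominated_graph_inj G x r s :
  dominated_graph G -> G (x, r) -> G (x, s) -> r = s.
Proof.
move=> [GL Gp] Gr Gs; apply/eqP; rewrite eq_le.
have half u v : G (x, u) -> G (x, v) -> v <= u.
  move=> Gu Gv; have := Gp _ _ (GL (-1) _ _ _ _ Gu Gv).
  by rewrite scaleN1r addNr p0 mulN1r addrC subr_le0.
by apply/andP; split; exact: half.
Qed.

(** The one-dimensional extension: the value [r] at [x] has to satisfy
    s - p (y - x) <= r <= p (y + x) - s on the graph, and subadditivity of [p]
    makes the supremum of the left-hand sides a valid choice. *)
Lemma dominated_graph_step G x : dominated_graph G -> G !=set0 ->
  exists H, [/\ dominated_graph H, G `<=` H & exists r, H (x, r)].
Proof.
move=> PG [[x1 r1] G1]; have [GL Gp] := PG; have G0 := dominated_graph0 PG G1.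
pose S := [set u.2 - p (u.1 - x) | u in G].
have S_le y s : G (y, s) -> ubound S (p (y + x) - s).
  move=> Gy _ [[z t] Gz <-] /=.
  rewrite lerBlDr addrAC lerBrDr.
  have := Gp _ _ (GL 1 _ _ _ _ Gz Gy); rewrite scale1r mul1r => /le_trans; apply.
  by have := pD (y + x) (z - x); rewrite addrACA subrr addr0 (addrC y).
have hS : has_sup S.
  split; first by exists (0 - p (0 - x)), (0, 0).
  by exists (p (0 + x) - 0); exact: S_le.
pose r := sup S.
have rD y s : G (y, s) -> s + r <= p (y + x).
  by move=> Gy; rewrite addrC -lerBrDr; apply: ge_sup; [exact: hS.1|exact: S_le].
have rB y s : G (y, s) -> s - r <= p (y - x).
  move=> Gy; rewrite lerBlDr -lerBlDl; apply: ub_le_sup; first exact: hS.2.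
  by exists (y, s).
exists [set u | exists y s t, G (y, s) /\ u = (y + t *: x, s + t * r)]; split.
- split=> [a _ _ _ _ [y [s [t [Gy [-> ->]]]]] [y' [s' [t' [Gy' [-> ->]]]]]|].
    exists (a *: y + y'), (a * s + s'), (a * t + t'); split; first exact: GL.
    rewrite scalerDr mulrDr scalerDl mulrDl !scalerA !mulrA.
    by rewrite [in X in (X, _)]addrACA [in X in (_, X)]addrACA.
  move=> _ _ [y [s [t [Gy [-> ->]]]]].
  have [t0|t0|->] := ltgtP t 0; last by rewrite scale0r mul0r !addr0; exact: Gp.
  - have a0 : 0 < - t by rewrite oppr_gt0.
    have := rB _ _ (dominated_graphZ (- t)^-1 PG Gy).
    rewrite -(ler_pM2l a0) -pZ ?(ltW a0)// scalerBr scalerA mulfV ?gt_eqF// scale1r.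
    by rewrite mulrBr mulrA mulfV ?gt_eqF// mul1r scaleNr mulNr !opprK.
  - have := rD _ _ (dominated_graphZ t^-1 PG Gy).
    rewrite -(ler_pM2l t0) -pZ ?(ltW t0)// scalerDr scalerA mulfV ?gt_eqF// scale1r.
    by rewrite mulrDr mulrA mulfV ?gt_eqF// mul1r.
- by move=> [y s] Gy; exists y, s, 0; rewrite scale0r mul0r !addr0.
- by exists r; exists 0, 0, 1; rewrite scale1r mul1r !add0r.
Qed.

(** Zorn's lemma among the dominated graphs that contain the point (x0, p x0),
    or are empty; the line through that point is one of them. *)
Lemma hahn_banach x0 : exists f : V -> R,
  [/\ linear (f : V -> R^o), forall x, f x <= p x & f x0 = p x0].
Proof.
pose P G := dominated_graph G /\ (G !=set0 -> G (x0, p x0)).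
have [F FP Ftot|G [[PG Gx0] Gmax]] := @Zorn_bigcup _ P.
  split; last first.
    by move=> [u [A FA Au]]; exists A => //; apply: (FP _ FA).2; exists u.
  split=> [a x y r s [A FA Ax] [B FB By]|x r [A FA Ax]].
    have [AB|BA] := Ftot _ _ FA FB.
      by exists B => //; apply: (FP _ FB).1.1 => //; exact: AB.
    by exists A => //; apply: (FP _ FA).1.1 => //; exact: BA.
  exact: (FP _ FA).1.2.
have G0 : G !=set0.
  have [//|/nonemptyPn GE] := pselect (G !=set0).
  have L1 : [set u | exists t, u = (t *: x0, t * p x0)] (x0, p x0).
    by exists 1; rewrite scale1r mul1r.
  exfalso; apply: (Gmax [set u | exists t, u = (t *: x0, t * p x0)]).
    by rewrite GE; split=> [u//|/(_ _ L1)].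
  by split=> // ; exact: dominated_graph_line.
have Gtot x : exists r, G (x, r).
  have [H [PH GH [r Hx]]] := dominated_graph_step x PG G0.
  exists r; apply: contrapT => nGx; apply: (Gmax H).
    by split=> // /(_ _ Hx).
  by split=> // _; apply/GH/Gx0.
have [f Gf] := choice Gtot.
exists f; split=> [a x y|x|].
- by apply: (dominated_graph_inj PG (Gf _)); exact: PG.1.
- exact: PG.2.
- by apply: (dominated_graph_inj PG (Gf _)); exact: Gx0.
Qed.

End HahnBanach.

Section HahnBanachNormed.
Context {R : realType}.

Lemma dominated_functional_bounded (Z : normedModType R) (f : Z -> R) :
  linear (f : Z -> R^o) -> (forall x, f x <= `|x|) ->
  exists g : dual Z, `|g| <= 1 /\ g =1 f.
Proof.
move=> lf fx.
pose h : {linear Z -> R^o} := HB.pack f (GRing.isLinear.Build R Z R^o *:%R f lf).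
have fM x : `|f x : R^o| <= 1 * `|x|.
  rewrite mul1r ler_norml fx andbT lerNl.
  by rewrite -[- f x](linearN h) -[`|x|]normrN; exact: fx.
by exists (bounded_op_of lf fM); split=> //; exact: opnorm_le_mul.
Qed.

Lemma norming_functional (Z : normedModType R) (z : Z) :
  exists f : dual Z, `|f| <= 1 /\ f z = `|z|.
Proof.
have sn : sublinear (fun x : Z => `|x|).
  by split=> [x y|a x a0]; [exact: ler_normD|rewrite normrZ ger0_norm].
have [f [lf fN fz]] := hahn_banach sn z.
by have [g [g1 gf]] := dominated_functional_bounded lf fN; exists g; rewrite gf.
Qed.

(** Hahn-Banach for the distance to [W], which is sublinear, at most the norm,
    zero on [W] and at least [d] at [z]. *)
Lemma separating_functional (Z : normedModType R) (W : set Z) (z : Z) (d : R) :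
  (forall a x y, W x -> W y -> W (a *: x + y)) -> W 0 -> 0 < d ->
  (forall w, W w -> d <= `|z - w|) ->
  exists f : dual Z, (forall w, W w -> f w = 0) /\ f z != 0.
Proof.
move=> WL W0 d0 dz.
pose p x := inf [set `|x - w| | w in W].
have hp x : has_inf [set `|x - w| | w in W].
  by split; [exists `|x - 0|, 0|exists 0 => _ [w Ww <-]].
have p_le x w : W w -> p x <= `|x - w|.
  by move=> Ww; apply: inf_lbound; [exact: (hp x).2|exists w].
have p_ge x r : (forall w, W w -> r <= `|x - w|) -> r <= p x.
  move=> rw; apply: lb_le_inf; first exact: (hp x).1.
  by move=> _ [w Ww <-]; exact: rw.
have WZ a x : W x -> W (a *: x).
  by move=> Wx; have := WL a _ _ Wx W0; rewrite addr0.
have ps : sublinear p.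
  split=> [x y|].
    rewrite -lerBlDr; apply: (p_ge) => w Ww; rewrite lerBlDr -lerBlDl.
    apply: (p_ge) => v Wv; rewrite lerBlDl.
    have := p_le (x + y) _ (WL 1 _ _ Ww Wv).
    rewrite scale1r opprD addrACA => /le_trans; apply; exact: ler_normD.
  (* Used for a and for its inverse, this inequality is an equality. *)
  have half a x : 0 < a -> a * p x <= p (a *: x).
    move=> a0; apply: (p_ge) => w Ww; rewrite mulrC -ler_pdivlMr//.
    rewrite (le_trans (p_le x _ (WZ a^-1 _ Ww)))//.
    rewrite ler_pdivlMr// -[X in _ * X](gtr0_norm a0) mulrC -normrZ scalerBr.
    by rewrite scalerA mulfV ?gt_eqF// scale1r.
  move=> a x; rewrite le_eqVlt => /predU1P[<-|a0].
    rewrite scale0r mul0r; apply/eqP; rewrite eq_le p_ge// andbT.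
    by rewrite (le_trans (p_le _ _ W0))// subr0 normr0.
  apply/eqP; rewrite eq_le half// andbT.
  have ai : 0 < a^-1 by rewrite invr_gt0.
  have := half _ (a *: x) ai; rewrite scalerA mulVf ?gt_eqF// scale1r.
  by rewrite mulrC ler_pdivrMr// mulrC.
have [f [lf fp fz]] := hahn_banach ps z.
have fx x : f x <= `|x|.
  by rewrite (le_trans (fp x))// (le_trans (p_le _ _ W0))// subr0.
have [g [_ gf]] := dominated_functional_bounded lf fx.
have g_le w : W w -> g w <= 0.
  move=> Ww; rewrite gf (le_trans (fp w))// (le_trans (p_le _ _ Ww))//.
  by rewrite subrr normr0.
exists g; split=> [w Ww|]; last first.
  by rewrite gf fz gt_eqF// (lt_le_trans d0)// p_ge.
apply/eqP; rewrite eq_le g_le//= -oppr_le0 -linearN g_le//.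
by rewrite -scaleN1r; exact: WZ.
Qed.

End HahnBanachNormed.

(** * The renorming of ell1 *)

Section Ell1Membership.
Context {R : realType}.
Implicit Types u : nat -> R.

Lemma ell1_partial_le (u : ell1 R) n : \sum_(0 <= i < n) `|u i| <= `|u|.
Proof.
apply: (@nondecreasing_cvgn_le _ (series (fun n => `|u n|))).
  by apply/nondecreasing_seqP => k; rewrite /series/= big_nat_recr//= lerDl.
exact: ell1_cvg.
Qed.

Lemma ell1_norm_le (u : ell1 R) M :
  (forall n, \sum_(0 <= i < n) `|u i| <= M) -> `|u| <= M.
Proof.
by move=> uM; apply: limr_le; [exact: ell1_cvg|exact: nearW].
Qed.

Lemma is_ell1_bounded u M :
  (forall n, \sum_(0 <= i < n) `|u i| <= M) -> u \in @is_ell1 R.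
Proof.
move=> uM; rewrite inE; apply: nondecreasing_is_cvgn.
  by apply/nondecreasing_seqP => k; rewrite /series/= big_nat_recr//= lerDl.
by exists M => _ [n _ <-]; exact: uM.
Qed.

Definition ell1_of u M (uM : forall n, \sum_(0 <= i < n) `|u i| <= M) : ell1 R :=
  Ell1 (is_ell1_bounded uM).

Lemma ell1_eq (u v : ell1 R) : u =1 v -> u = v.
Proof. by move=> uv; apply/val_inj/funext. Qed.

End Ell1Membership.

Section Renorming.
Context {R : realType}.

(** The two quantities are the ell1 norm and the supremum norm of the tail
    (u_1, u_2, ...), the latter increased by |u_0|; taking both at a finite
    stage makes the norm a single supremum of real numbers. *)
Definition renorm_at (u : nat -> R) n : R :=
  Num.max (\sum_(0 <= i < n) `|u i.+1|) (`|u 0| + `|u n.+1|).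

Definition renorm (u : nat -> R) : R := sup (range (renorm_at u)).

Lemma renorm_at_le_ell1 (u : ell1 R) n : renorm_at u n <= `|u|.
Proof.
rewrite ge_max; apply/andP; split.
  by rewrite (le_trans _ (ell1_partial_le u n.+1))// big_nat_recl//= lerDr.
rewrite (le_trans _ (ell1_partial_le u n.+2))// big_nat_recl//= lerD2l.
by rewrite big_nat_recr//= lerDr sumr_ge0.
Qed.

Lemma has_sup_renorm (u : ell1 R) : has_sup (range (renorm_at u)).
Proof.
split; first by exists (renorm_at u 0), 0%N.
by exists `|u| => _ [n _ <-]; exact: renorm_at_le_ell1.
Qed.

Lemma renorm_sum_ub (u : ell1 R) n : \sum_(0 <= i < n) `|u i.+1| <= renorm u.
Proof.
rewrite (@le_trans _ _ (renorm_at u n))//; first by rewrite le_max lexx.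
by apply: ub_le_sup; [exact: (has_sup_renorm u).2|exists n].
Qed.

Lemma renorm_pair_ub (u : ell1 R) n : `|u 0| + `|u n.+1| <= renorm u.
Proof.
rewrite (@le_trans _ _ (renorm_at u n))//; first by rewrite le_max lexx orbT.
by apply: ub_le_sup; [exact: (has_sup_renorm u).2|exists n].
Qed.

Lemma renorm_le (u : nat -> R) M :
  (forall n, \sum_(0 <= i < n) `|u i.+1| <= M) ->
  (forall n, `|u 0| + `|u n.+1| <= M) -> renorm u <= M.
Proof.
move=> uM1 uM2; apply: ge_sup; first by exists (renorm_at u 0), 0%N.
by move=> _ [n _ <-]; rewrite ge_max uM1 uM2.
Qed.

Lemma ler_renormD (u v : ell1 R) : renorm (u + v : ell1 R) <= renorm u + renorm v.
Proof.
apply: renorm_le => n.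
  rewrite (le_trans _ (lerD (renorm_sum_ub u n) (renorm_sum_ub v n)))//.
  by rewrite -big_split/= ler_sum// => i _; exact: ler_normD.
rewrite (le_trans _ (lerD (renorm_pair_ub u n) (renorm_pair_ub v n)))//.
by rewrite addrACA lerD//; exact: ler_normD.
Qed.

Lemma renormZ (l : R) (u : ell1 R) : renorm (l *: u : ell1 R) = `|l| * renorm u.
Proof.
have half (a : R) (v : ell1 R) : renorm (a *: v : ell1 R) <= `|a| * renorm v.
  apply: renorm_le => n.
    rewrite (le_trans _ (ler_wpM2l (normr_ge0 a) (renorm_sum_ub v n)))//.
    by rewrite mulr_sumr ler_sum// => i _; rewrite normrM.
  by rewrite !normrM -mulrDr ler_wpM2l// renorm_pair_ub.
apply/eqP; rewrite eq_le half/=.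
have [->|l0] := eqVneq l 0.
  rewrite normr0 mul0r; apply: le_trans (renorm_pair_ub (0 *: u) 0).
  exact: addr_ge0.
have := half l^-1 (l *: u); rewrite scalerA mulVf// scale1r normfV.
by rewrite -ler_pdivrMl ?invr_gt0 ?normr_gt0// invrK.
Qed.

Lemma renorm_eq0 (u : ell1 R) : renorm u = 0 -> u = 0.
Proof.
move=> u0; apply: ell1_eq => n.
have u_le m : `|u 0| + `|u m.+1| <= 0 by rewrite -u0 renorm_pair_ub.
apply/eqP; rewrite -normr_le0; case: n => [|n].
  by rewrite (le_trans _ (u_le 0))// lerDl.
by rewrite (le_trans _ (u_le n))// lerDr.
Qed.

End Renorming.

(** An alias of ell1, so that it can carry another norm. *)
Definition renormed (R : realType) : Type := ell1 R.

HB.instance Definition _ (R : realType) :=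
  GRing.Lmodule.copy (renormed R) (ell1 R).
HB.instance Definition _ (R : realType) :=
  Lmodule_isNormed.Build R (renormed R) ler_renormD renormZ renorm_eq0.

Section RenormedTheory.
Context {R : realType}.
Notation X := (renormed R).
Implicit Types x y : X.

Definition coords x : nat -> R := ell1_seq x.

Lemma coordsD x y n : coords (x + y) n = coords x n + coords y n.
Proof. by []. Qed.
Lemma coordsN x n : coords (- x) n = - coords x n.
Proof. by []. Qed.
Lemma coordsZ a x n : coords (a *: x) n = a * coords x n.
Proof. by []. Qed.

End RenormedTheory.
Arguments coords {R} x _ : simpl never.

Section RenormedBasis.
Context {R : realType}.
Notation X := (renormed R).
Implicit Types x y : X.

Definition ell1_norm_of x : R := `|(x : ell1 R)|.

Lemma renormed_le_ell1 x : `|x| <= ell1_norm_of x.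
Proof.
apply: ge_sup => [|_ [n _ <-]]; last exact: renorm_at_le_ell1.
by exists (renorm_at x 0), 0%N.
Qed.

Lemma sum_coords_le x n : \sum_(0 <= i < n) `|coords x i| <= 2 * `|x|.
Proof.
case: n => [|n]; first by rewrite big_geq// mulr_ge0.
rewrite big_nat_recl//= mulr_natl mulr2n lerD//; last exact: renorm_sum_ub.
by apply: le_trans (renorm_pair_ub x 0); rewrite lerDl.
Qed.

Lemma ell1_le_renormed x : ell1_norm_of x <= 2 * `|x|.
Proof. by apply: ell1_norm_le => n; exact: sum_coords_le. Qed.

Lemma coord_le x n : `|coords x n| <= `|x|.
Proof.
case: n => [|n].
  by apply: le_trans (renorm_pair_ub x 0); rewrite lerDl.
by apply: le_trans (renorm_pair_ub x n); rewrite lerDr.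
Qed.

Lemma sum_delta_le n m : \sum_(0 <= i < m) `|(i == n)%:R : R| <= 1.
Proof.
have -> : \sum_(0 <= i < m) `|(i == n)%:R : R| = (n < m)%N%:R.
  elim: m => [|m IH]; first by rewrite big_geq.
  rewrite big_nat_recr//= IH ltnS normr_nat.
  by case: ltngtP; rewrite ?add0r ?addr0.
by case: (n < m)%N; rewrite ?ler01.
Qed.

Definition unit_vec n : X := ell1_of (sum_delta_le n).

Lemma coords_unit_vec n i : coords (unit_vec n) i = (i == n)%:R.
Proof. by []. Qed.

Lemma unit_vec_le1 n : `|unit_vec n| <= 1.
Proof.
apply: le_trans (renormed_le_ell1 _) _.
by apply: ell1_norm_le => m; exact: sum_delta_le.
Qed.

Lemma coords_sum (c : nat -> R) n k :
  coords (\sum_(0 <= i < n) c i *: unit_vec i) k = if (k < n)%N then c k else 0.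
Proof.
elim: n => [|n IH]; first by rewrite big_geq.
rewrite big_nat_recr// coordsD IH coordsZ coords_unit_vec ltnS.
by case: ltngtP => [kn|kn|->]; rewrite ?mulr0 ?addr0 ?mulr1 ?add0r.
Qed.

Lemma unit_vec_expansion x :
  (fun n => \sum_(0 <= i < n) coords x i *: unit_vec i) @ \oo --> x.
Proof.
apply/cvgrPdist_le => e e0.
have cx : series (fun n => `|coords x n|) @ \oo --> ell1_norm_of x.
  exact: (@ell1_cvg _ x).
move/cvgrPdist_le : cx => /(_ e e0); apply: filterS => n.
move=> /(le_trans (ler_norm _)) xn; apply: le_trans xn.
apply: le_trans (renormed_le_ell1 _) _; rewrite lerBrDr.
set y := x - _.
have y0 i : (i < n)%N -> coords y i = 0.
  by move=> i_n; rewrite coordsD coordsN coords_sum i_n subrr.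
have yx i : (n <= i)%N -> coords y i = coords x i.
  by move=> ni; rewrite coordsD coordsN coords_sum ltnNge ni/= subr0.
rewrite -lerBrDr; apply: (ell1_norm_le (u := y)) => m.
change (\sum_(0 <= i < m) `|coords y i| <=
  ell1_norm_of x - \sum_(0 <= i < n) `|coords x i|); rewrite lerBrDr.
have sum0 k : (k <= n)%N -> \sum_(0 <= i < k) `|coords y i| = 0.
  move=> kn; rewrite big_nat_cond big1// => i /andP[/andP[_ ik] _].
  by rewrite y0 ?normr0// (leq_trans ik).
have [nm|/ltnW mn] := leqP n m; last first.
  by rewrite sum0// add0r; exact: ell1_partial_le.
have -> : \sum_(0 <= i < m) `|coords y i| = \sum_(n <= i < m) `|coords x i|.
  rewrite (big_cat_nat (leq0n n) nm)/= sum0// add0r.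
  by apply: eq_big_nat => i /andP[ni _]; congr (`|_|); exact: yx.
apply: le_trans (ell1_partial_le x m).
by rewrite [leRHS](big_cat_nat (leq0n n) nm)/= addrC.
Qed.

Lemma functional_expansion (f : dual X) x :
  (fun n => \sum_(0 <= i < n) coords x i * f (unit_vec i)) @ \oo --> f x.
Proof.
rewrite (_ : (fun n => _) =
    (fun n => f (\sum_(0 <= i < n) coords x i *: unit_vec i))).
  apply: continuous_cvg; first exact: boundedOp_continuous.
  exact: unit_vec_expansion.
by apply/funext => n; rewrite linear_sum; apply: eq_bigr => i _; rewrite linearZ.
Qed.

(** The difference is the sum of the terms of index at least [n], whose
    coefficients are at most [e]; the factor 2 compares the ell1 norm with the
    norm of X. *)
Lemma functional_tail_le (f : dual X) x n (e : R) :
  (forall i, (n <= i)%N -> `|f (unit_vec i)| <= e) ->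
  `|f x - \sum_(0 <= i < n) coords x i * f (unit_vec i)| <= 2 * e * `|x|.
Proof.
move=> fe; have e0 : 0 <= e by apply: le_trans (fe n _).
set s := \sum_(0 <= i < n) _.
have h : (fun m => `|\sum_(0 <= i < m) coords x i * f (unit_vec i) - s|) @ \oo
    --> `|f x - s|.
  apply: cvg_norm; apply: cvgB; last exact: cvg_cst.
  exact: functional_expansion.
rewrite -(cvg_lim _ h)//; apply: limr_le; first by apply/cvg_ex; eexists; exact: h.
near=> m.
have nm : (n <= m)%N by near: m; exists n.
rewrite /s [X in X - _](big_cat_nat (leq0n n) nm)/= addrAC subrr add0r.
rewrite (le_trans (ler_norm_sum _ _ _))//.
apply: (@le_trans _ _ (\sum_(n <= i < m) e * `|coords x i|)).
  rewrite big_nat_cond [leRHS]big_nat_cond ler_sum// => i /andP[/andP[ni _] _].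
  by rewrite normrM mulrC ler_wpM2r// fe.
rewrite -mulr_sumr -mulrA mulrCA ler_wpM2l//.
apply: le_trans (sum_coords_le x m).
by rewrite [leRHS](big_cat_nat (leq0n n) nm)/= lerDr sumr_ge0.
Unshelve. all: by end_near. Qed.

End RenormedBasis.

(** * Linear isometries and completeness *)

Section IsometryComplete.
Context {R : realType}.

Lemma linear_isometryB (V W : normedModType R) (J : V -> W) x y :
  linear_isometry J -> `|J x - J y| = `|x - y|.
Proof.
move=> [lJ nJ]; have := lJ (-1) y x; rewrite !scaleN1r => h.
by rewrite -nJ addrC -h addrC.
Qed.

(** This serves twice: for the predual, closed in the dual of X, and for X,
    isometric to the dual of the predual.  The closedness of the range is
    written out with approximations. *)
Lemma isometry_complete (V : normedModType R) (W : completeNormedModType R)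
    (J : V -> W) :
  linear_isometry J ->
  (forall w, (forall e, 0 < e -> exists v, `|w - J v| <= e) ->
    exists v, J v = w) ->
  forall F : set_system V, ProperFilter F -> cauchy F -> cvg F.
Proof.
move=> JI Jclosed F FF cF.
have cF' e : 0 < e -> exists v, F (ball v e).
  by move=> e0; move: cF => /cauchyP /(_ e e0).
have cJ : cvg (J @ F).
  apply/cauchy_cvgP/cauchyP => e e0.
  have [v Fv] := cF' e e0; exists (J v).
  suff : F [set u | ball (J v) e (J u)] by [].
  apply: filterS Fv => u; rewrite -!ball_normE /ball_ /=.
  by rewrite linear_isometryB.
have [w Fw] : exists w : W, J @ F --> w by exists (lim (J @ F)).
have [v Jv] : exists v, J v = w.
  apply: Jclosed => e e0.
  have Fe : F [set u | `|w - J u| <= e] by move/cvgrPdist_le : Fw => /(_ e e0).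
  by have [u wu] := filter_ex Fe; exists u.
apply/cvg_ex; exists v; apply/cvgrPdist_le => e e0.
move/cvgrPdist_le : Fw => /(_ e e0).
by apply: filterS => u; rewrite -Jv linear_isometryB.
Qed.

Lemma complete_isometry_closed (V : completeNormedModType R)
    (W : normedModType R) (J : V -> W) (w : W) :
  linear_isometry J -> (forall e, 0 < e -> exists v, `|w - J v| <= e) ->
  exists v, J v = w.
Proof.
move=> JI wJ.
have /choice[v vJ] : forall n : nat, exists v, `|w - J v| <= n.+1%:R^-1.
  by move=> n; apply: wJ; rewrite invr_gt0.
have Jvw : J \o v @ \oo --> w.
  apply/cvgrPdist_le => e e0.
  have /cvgrPdist_le/(_ e e0) := @cvg_harmonic R.
  apply: filterS => n; rewrite sub0r normrN => /(le_trans (ler_norm _)).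
  exact: le_trans (vJ n).
have cv : cvg (v @ \oo).
  apply/cauchy_cvgP/cauchyP => e e0.
  have e20 : 0 < e / 2 by rewrite divr_gt0.
  move/cvgrPdist_lt : Jvw => /(_ _ e20) Je.
  have [n wn] := filter_ex Je.
  exists (v n); suff : \forall m \near \oo, ball (v n) e (v m) by [].
  apply: filterS Je => m wm; rewrite -ball_normE /ball_ /=.
  rewrite -(linear_isometryB _ _ JI) (splitr e).
  have -> : J (v n) - J (v m) = (w - J (v m)) - (w - J (v n)).
    by rewrite [RHS]addrC opprB addrA subrK.
  by rewrite (le_lt_trans (ler_normB _ _))// ltrD.
have [l vl] : exists l : V, v @ \oo --> l by exists (lim (v @ \oo)).
exists l; have Jl : J \o v @ \oo --> J l.
  apply/cvgrPdist_le => e e0; move/cvgrPdist_le : vl => /(_ e e0).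
  by apply: filterS => n; rewrite /= linear_isometryB.
by apply: (cvg_unique _ Jl Jvw); exact: norm_hausdorff.
Qed.

End IsometryComplete.

(** * The predual *)

Section Predual.
Context {R : realType}.
Notation X := (renormed R).

(** Under the identification of the dual of X with the bounded sequences, these
    are the sequences tending to 0.  Describing them inside the dual of X gives
    the right norm and completeness at once. *)
Definition is_predual : {pred dual X} :=
  [pred f : dual X | `[< (fun n => f (unit_vec n)) @ \oo --> (0 : R) >]].

Record predual := Predual {
  predual_val :> boundedOp X R^o;
  predualP : predual_val \in is_predual }.

HB.instance Definition _ := [isSub for predual_val].
HB.instance Definition _ := [Choice of predual by <:].

Lemma is_predual_submod_closed : submod_closed is_predual.
Proof.
split=> [|a f g]; rewrite !inE; first exact: cvg_cst.
move=> f0 g0.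
have -> : (fun n => (a *: f + g) (unit_vec n)) =
    (fun n => a * f (unit_vec n) + g (unit_vec n)) by [].
rewrite -[0 in X in _ --> X](addr0 (0 : R)) -[0 in X in _ --> X + _](mulr0 a).
by apply: cvgD => //; apply: cvgM => //; exact: cvg_cst.
Qed.

HB.instance Definition _ := GRing.isSubmodClosed.Build R (dual X) is_predual
  is_predual_submod_closed.
HB.instance Definition _ := [SubChoice_isSubLmodule of predual by <:].

Implicit Types f g : predual.

Definition predual_norm f : R := `|predual_val f|.

Lemma ler_predual_normD f g :
  predual_norm (f + g) <= predual_norm f + predual_norm g.
Proof. exact: ler_normD. Qed.

Lemma predual_normZ (l : R) f : predual_norm (l *: f) = `|l| * predual_norm f.
Proof. exact: normrZ. Qed.

Lemma predual_norm_eq0 f : predual_norm f = 0 -> f = 0.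
Proof. by move=> /normr0_eq0 f0; exact: val_inj. Qed.

HB.instance Definition _ := Lmodule_isNormed.Build R predual
  ler_predual_normD predual_normZ predual_norm_eq0.

Lemma predual_normE f : `|f| = `|predual_val f|.
Proof. by []. Qed.

Lemma predual_vanish f : (fun n => f (unit_vec n)) @ \oo --> (0 : R).
Proof. by have := predualP f; rewrite inE. Qed.

Lemma predual_closed (g : dual X) :
  (forall e, 0 < e -> exists f, `|g - predual_val f| <= e) ->
  exists f, predual_val f = g.
Proof.
move=> gf; suff gP : g \in is_predual by exists (Predual gP).
rewrite inE; apply/cvgrPdist_le => e e0.
have e20 : 0 < e / 2 by rewrite divr_gt0.
have [f gfe] := gf _ e20.
have /cvgrPdist_le/(_ _ e20) := predual_vanish f.
apply: filterS => n; rewrite !sub0r !normrN => fn.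
have -> : g (unit_vec n) = (g - predual_val f) (unit_vec n) + f (unit_vec n).
  by rewrite boundedOp_add boundedOp_opp subrK.
rewrite (le_trans (ler_normD _ _))// (splitr e) lerD//.
rewrite (le_trans (boundedOp_ub _ _))// -[leRHS]mulr1.
by rewrite ler_pM// unit_vec_le1.
Qed.

Lemma predual_complete (F : set_system predual) :
  ProperFilter F -> cauchy F -> cvg F.
Proof.
apply: (@isometry_complete R predual (dual X) predual_val) => //.
exact: predual_closed.
Qed.

HB.instance Definition _ := Uniform_isComplete.Build predual predual_complete.

End Predual.
Arguments predual : clear implicits.

Section Duality.
Context {R : realType}.
Notation X := (renormed R).
Notation Y := (predual R).

Lemma predual_ub (f : Y) (x : X) : `|f x| <= `|f| * `|x|.
Proof. exact: boundedOp_ub. Qed.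

Lemma coord_linear n : linear (fun x : X => coords x n : R^o).
Proof. by []. Qed.

Lemma coord_bounded n (x : X) : `|coords x n : R^o| <= 1 * `|x|.
Proof. by rewrite mul1r coord_le. Qed.

Lemma coord_is_predual n :
  bounded_op_of (coord_linear n) (coord_bounded n) \in @is_predual R.
Proof.
rewrite inE; apply: cvg_near_cst; near=> m.
rewrite /= coords_unit_vec; suff /negbTE-> : n != m by [].
by rewrite ltn_eqF//; near: m; exists n.+1.
Unshelve. all: by end_near. Qed.

Definition coordf n : Y := Predual (coord_is_predual n).

Definition coord_comb (c : nat -> R) n : Y :=
  \sum_(0 <= i < n) c i *: coordf i.

Lemma coord_combE c n (x : X) :
  coord_comb c n x = \sum_(0 <= i < n) coords x i * c i.
Proof.
rewrite /coord_comb; elim: n => [|n IH]; first by rewrite !big_geq.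
by rewrite !big_nat_recr//= -IH [coords x n * _]mulrC.
Qed.

Lemma coord_comb_image c n (phi : dual Y) :
  phi (coord_comb c n) = \sum_(0 <= i < n) phi (coordf i) * c i.
Proof.
rewrite /coord_comb linear_sum; apply: eq_bigr => i _.
by rewrite linearZ/= mulrC.
Qed.

Lemma eval_linear (x : X) : linear (fun f : Y => f x : R^o).
Proof. by []. Qed.

Lemma eval_bounded (x : X) (f : Y) : `|f x : R^o| <= `|x| * `|f|.
Proof. by rewrite mulrC predual_ub. Qed.

Definition duality (x : X) : dual Y :=
  bounded_op_of (@eval_linear x) (@eval_bounded x).

Lemma dualityE x (f : Y) : duality x f = f x. Proof. by []. Qed.

Lemma duality_linear : linear duality.
Proof. by move=> a x y; apply: boundedOp_eq => f; rewrite dualityE linearP. Qed.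

Lemma predual_norm_le (f : Y) (M : R) :
  0 <= M -> (forall x, `|f x| <= M * `|x|) -> `|f| <= M.
Proof. by move=> M0 fM; rewrite predual_normE; exact: opnorm_le_mul. Qed.

(** Only the lower bound needs an idea: the norm of X is the supremum of the
    values at [x] of sign combinations of coordinates, and each of these has
    norm at most 1 by the definition of the norm of X. *)
Lemma duality_norm x : `|duality x| = `|x|.
Proof.
apply/eqP; rewrite eq_le; apply/andP; split.
  by apply: opnorm_le_mul => // f; rewrite dualityE eval_bounded.
have test (f : Y) : (forall y, `|f y| <= `|y|) -> f x <= `|duality x|.
  move=> fy; have f1 : `|f| <= 1.
    by apply: predual_norm_le => // y; rewrite mul1r.
  rewrite -dualityE (le_trans (ler_norm _))// (le_trans (boundedOp_ub _ _))//.
  by rewrite -[leRHS]mulr1 ler_wpM2l.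
apply: renorm_le => n.
  pose c i := if i is _.+1 then Num.sg (coords x i) else 0.
  have cE y : coord_comb c n.+1 y =
      \sum_(0 <= i < n) coords y i.+1 * Num.sg (coords x i.+1).
    by rewrite coord_combE big_nat_recl//= mulr0 add0r.
  have -> : \sum_(0 <= i < n) `|coords x i.+1| = coord_comb c n.+1 x.
    by rewrite cE; apply: eq_bigr => i _; rewrite mulrC -normrEsg.
  apply: test => y; rewrite cE (le_trans (ler_norm_sum _ _ _))//.
  apply: le_trans (renorm_sum_ub y n); apply: ler_sum => i _.
  by rewrite normrM normr_sg ler_piMr// lern1 leq_b1.
pose f : Y := Num.sg (coords x 0) *: coordf 0
  + Num.sg (coords x n.+1) *: coordf n.+1.
have fE y : f y = Num.sg (coords x 0) * coords y 0
  + Num.sg (coords x n.+1) * coords y n.+1 by [].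
have -> : `|coords x 0| + `|coords x n.+1| = f x by rewrite fE -!normrEsg.
apply: test => y; rewrite fE (le_trans (ler_normD _ _))//.
apply: le_trans (renorm_pair_ub y n); rewrite !normrM !normr_sg.
by rewrite lerD// ler_piMl// lern1 leq_b1.
Qed.

Lemma duality_isometry : linear_isometry duality.
Proof. by split; [exact: duality_linear|exact: duality_norm]. Qed.

(** The values of [phi] at the coordinates form a sequence of ell1, by testing
    [phi] on sign combinations of coordinates, whose norm is at most 2.  This
    sequence represents [phi] because finite combinations of coordinates are
    dense in the predual. *)
Lemma duality_surjective (phi : dual Y) : exists x, duality x = phi.
Proof.
pose u i := phi (coordf i) : R.
have uM n : \sum_(0 <= i < n) `|u i| <= `|phi| * 2.
  have -> : \sum_(0 <= i < n) `|u i| = phi (coord_comb (fun i => Num.sg (u i)) n).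
    by rewrite coord_comb_image; apply: eq_bigr => i _; rewrite mulrC -normrEsg.
  rewrite (le_trans (ler_norm _))// (le_trans (boundedOp_ub _ _))//.
  rewrite ler_wpM2l//; apply: predual_norm_le => // x; rewrite coord_combE.
  rewrite (le_trans (ler_norm_sum _ _ _))//.
  apply: le_trans (sum_coords_le x n); apply: ler_sum => i _.
  by rewrite normrM normr_sg ler_piMr// lern1 leq_b1.
pose x : X := ell1_of uM; exists x; apply: boundedOp_eq.
suff dual_eq (f : Y) : f x = phi f by [].
have fx := @functional_expansion R f x.
have phif : (fun n => \sum_(0 <= i < n) coords x i * f (unit_vec i)) @ \oo
    --> phi f; last first.
  by apply: (cvg_unique _ fx phif); exact: norm_hausdorff.
have -> : (fun n => \sum_(0 <= i < n) coords x i * f (unit_vec i)) =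
    (fun n => phi (coord_comb (fun i => f (unit_vec i)) n)).
  by apply/funext => n; rewrite coord_comb_image.
apply: continuous_cvg; first exact: boundedOp_continuous.
apply/cvgrPdist_le => e e0.
have e20 : 0 < e / 2 by rewrite divr_gt0.
have /cvgrPdist_le/(_ _ e20)[N _ fN] := predual_vanish f.
exists N => // n /= Nn.
apply: predual_norm_le => [|y]; first exact: ltW.
have -> : (f - coord_comb (fun i => f (unit_vec i)) n) y =
    f y - \sum_(0 <= i < n) coords y i * f (unit_vec i).
  by rewrite -coord_combE.
have -> : e = 2 * (e / 2) by rewrite mulrC divfK// pnatr_eq0.
apply: functional_tail_le => i ni.
by have := fN i (leq_trans Nn ni); rewrite sub0r normrN.
Qed.

Lemma duality_surjective_isometry : surjective_linear_isometry duality.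
Proof.
split; first exact: duality_isometry.
apply/seteqP; split=> // phi _.
by have [x <-] := duality_surjective phi; exists x.
Qed.

Lemma renormed_complete (F : set_system X) : ProperFilter F -> cauchy F -> cvg F.
Proof.
apply: (@isometry_complete R X (dual Y) duality duality_isometry) => phi _.
exact: duality_surjective.
Qed.

HB.instance Definition _ := Uniform_isComplete.Build X renormed_complete.

End Duality.

(** * Weak* null sequences detected by balls *)

Section BallSeparatedSequences.
Context {R : realType}.

Lemma cvg_norm_le (T : Type) (F : set_system T) (h : T -> R) (l c : R) :
  ProperFilter F -> h @ F --> l -> (\forall t \near F, `|h t| <= c) -> `|l| <= c.
Proof.
move=> FF hl hc; have nhl : (fun t => `|h t|) @ F --> `|l| by exact: cvg_norm.
rewrite -(cvg_lim _ nhl)//; apply: limr_le => //.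
by apply/cvg_ex; exists `|l|.
Qed.

Lemma ultra_bounded_cvg (T : Type) (U : set_system T) (h : T -> R) (M : R) :
  UltraFilter U -> (forall t, `|h t| <= M) -> exists l : R, h @ U --> l.
Proof.
move=> UU hM.
have hU : (h @ U) `[- M, M]%classic.
  suff : U [set t | `[- M, M]%classic (h t)] by [].
  by apply: filterE => t /=; rewrite in_itv/= -ler_norml.
have [l [_ ll]] := @segment_compact R (- M) M (h @ U) _ hU.
exists l => A Al; have [//|UA] := in_ultra_setVsetC (h @^-1` A) UU.
by have [r []] := ll (~` A) _ UA Al.
Qed.

(** Banach-Alaoglu along an ultrafilter: if T (u n) z stayed away from 0 along
    a subsequence, an ultrafilter refining that subsequence would make every
    T (u n) w converge.  The limit is a bounded functional, hence of the form
    T x, and balls survive the passage to the limit: [x] belongs to every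
    closed ball that eventually contains [u n].  The hypothesis then gives
    x = 0, although T x z does not vanish. *)
Lemma weak_star_null (X : normedModType R) (Z : normedModType R)
    (T : X -> dual Z) (u : nat -> X) (M : R) :
  surjective_linear_isometry T -> (forall n, `|u n| <= M) ->
  (forall x, (forall c r, (\forall n \near \oo, `|u n - c| <= r) ->
    `|x - c| <= r) -> x = 0) ->
  forall z, (fun n => T (u n) z) @ \oo --> (0 : R).
Proof.
move=> [TI Tsurj] uM u0 z; apply/cvgrPdist_lt => e e0; apply: contrapT => nF.
have [Tlin Tnorm] := TI.
pose D := [set n | e <= `|T (u n) z|].
have FF : ProperFilter (within D \oo).
  apply: Build_ProperFilter_ex => B BD; apply: contrapT => B0; apply: nF.
  have {}BD : \forall n \near \oo, D n -> B n := BD.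
  apply: filterS BD => n DB; rewrite sub0r normrN ltNge; apply/negP => en.
  by apply: B0; exists n; exact: DB.
(* The ultrafilter contains both the tails and the set of indices at which
   T (u n) z stays away from 0. *)
have [U [UU FU]] := ultraFilterLemma FF.
have UD : U D by apply: FU; exact: nearW.
have U_oo B : (\forall n \near \oo, B n) -> U B.
  by move=> ooB; apply: FU; apply: filterS ooB.
have Tu w n : `|T (u n) w| <= M * `|w|.
  by rewrite (le_trans (boundedOp_ub _ _))// ler_wpM2r// Tnorm.
have /choice[g gU] : forall w, exists l : R, (fun n => T (u n) w) @ U --> l.
  by move=> w; exact: ultra_bounded_cvg (Tu w).
have glin : linear (g : Z -> R^o).
  move=> a v w.
  have h : (fun n => T (u n) (a *: v + w)) @ U --> a * g v + g w.
    have -> : (fun n => T (u n) (a *: v + w)) =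
        (fun n => a * T (u n) v + T (u n) w).
      by apply/funext => n; rewrite linearP.
    by apply: cvgD; [apply: cvgM; [exact: cvg_cst|exact: gU]|exact: gU].
  by apply: (cvg_unique _ (gU _) h); exact: norm_hausdorff.
have gM w : `|g w : R^o| <= M * `|w|.
  by apply: (cvg_norm_le _ (gU w)); exact: nearW.
have [x Tx] : exists x, T x = bounded_op_of glin gM.
  have : range T (bounded_op_of glin gM) by rewrite Tsurj.
  by case=> x _; exists x.
have Txg w : T x w = g w by rewrite Tx.
have x0 : x = 0.
  apply: u0 => c r cr; have r0 : 0 <= r.
    by have [n] := filter_ex cr; exact: le_trans.
  rewrite -(linear_isometryB _ _ TI); apply: opnorm_le_mul => // w.
  rewrite boundedOp_add boundedOp_opp Txg.
  apply: (cvg_norm_le _ (cvgB (gU w) (cvg_cst (T c w)))).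
  apply: filterS (U_oo _ cr) => n unc.
  change (`|(T (u n) - T c) w| <= r * `|w|).
  rewrite (le_trans (boundedOp_ub _ _))// ler_wpM2r//.
  by rewrite (linear_isometryB _ _ TI).
have gz0 : g z = 0.
  have := Tnorm x; rewrite x0 normr0 => /normr0_eq0 T0.
  by rewrite -Txg x0 T0.
have zU := gU z; rewrite gz0 in zU.
move/cvgrPdist_lt : zU => /(_ e e0) zU.
have [n [Dn]] := filter_ex (filterI UD zU).
by rewrite /= sub0r normrN ltNge Dn.
Qed.

End BallSeparatedSequences.

(** * Uniqueness of the predual *)

Section StrongUniqueness.
Context {R : realType}.
Notation X := (renormed R).
Notation Y := (predual R).

Lemma aligned_sign (a : R) : exists s : R, `|s| <= 1 /\ `|a + s| = `|a| + 1.
Proof.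
have [a0|a0] := leP 0 a.
  by exists 1; rewrite normr1 !ger0_norm// addr_ge0.
exists (-1); rewrite normrN normr1; split=> //.
have a10 : a - 1 < 0 by lra.
by rewrite (ltr0_norm a0) (ltr0_norm a10) opprB addrC.
Qed.

(** In the vector e_n + s e_0 + t e_(k+1), the tail has at most two nonzero
    entries, at distinct places and of modulus at most 1.  So the ell1 norm of
    the tail is at most 2 and its supremum norm at most 1, while the coordinate
    of index 0 has modulus |s|. *)
Lemma unit_vec_shift_le (k n : nat) (s t : R) :
  `|s| <= 1 -> `|t| <= 1 -> (k.+1 < n)%N ->
  `|unit_vec n - (- (s *: unit_vec 0) - t *: unit_vec k.+1)| <= 2.
Proof.
move=> s1 t1 kn; set y := unit_vec n - _.
have cE i : coords y i = (i == n)%:R + (s * (i == 0%N)%:R + t * (i == k.+1)%:R).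
  by rewrite /y !(coordsD, coordsN, coordsZ) !coords_unit_vec opprD !opprK.
have sumS l m : \sum_(0 <= i < m) `|(i.+1 == l)%:R : R| <= 1.
  by apply: le_trans (sum_delta_le l m.+1); rewrite big_nat_recl//= lerDr.
have two : (2 : R) = 1 + 1 by rewrite -natr1.
apply: (renorm_le (u := coords y)) => m; rewrite two.
  apply: le_trans (lerD (sumS n m) (sumS k.+1 m)).
  rewrite -big_split/=; apply: ler_sum => i _; rewrite cE mulr0 add0r.
  by rewrite (le_trans (ler_normD _ _))// lerD2l normrM ler_piMl.
rewrite !cE eqxx mulr0 addr0 mulr1 mulr0 add0r; apply: lerD.
  by rewrite ltn_eqF ?add0r// (leq_trans _ kn).
have [->|mn] := eqVneq m.+1 n.
  by rewrite gtn_eqF// mulr0 addr0 normr1.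
by rewrite add0r normrM (le_trans (ler_piMr _ _))// normr_nat lern1 leq_b1.
Qed.

(** With the signs [s] and [t] of the coordinates 0 and [k.+1] of [x], the
    inequality of [unit_vec_shift_le] for [x] instead of e_n implies
    (|x_0| + 1) + (|x_(k+1)| + 1) <= 2. *)
Lemma unit_vec_separated (x : X) :
  (forall c r, (\forall n \near \oo, `|unit_vec n - c| <= r) -> `|x - c| <= r) ->
  x = 0.
Proof.
move=> xball.
have x_le k : `|coords x 0| + `|coords x k.+1| <= 0.
  have [s [s1 xs]] := aligned_sign (coords x 0).
  have [t [t1 xt]] := aligned_sign (coords x k.+1).
  pose c : X := - (s *: unit_vec 0) - t *: unit_vec k.+1.
  have c2 : \forall n \near \oo, `|unit_vec n - c| <= 2.
    by exists k.+2 => // n /= kn; exact: unit_vec_shift_le.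
  have := le_trans (renorm_pair_ub _ k) (xball c 2 c2).
  change (`|coords (x - c) 0| + `|coords (x - c) k.+1| <= 2 ->
    `|coords x 0| + `|coords x k.+1| <= 0).
  rewrite !(coordsD, coordsN, coordsZ) !coords_unit_vec eqxx !opprD !opprK.
  rewrite /= !mulr0 !mulr1 addr0 add0r xs xt; lra.
apply: renorm_eq0; apply/eqP; rewrite eq_le; apply/andP; split; last first.
  by apply: le_trans (renorm_pair_ub x 0); rewrite addr_ge0.
apply: renorm_le => n //.
rewrite big1// => i _; apply/eqP; rewrite -normr_le0 normr_id.
by apply: le_trans (x_le i); rewrite lerDr.
Qed.

Section OtherPredual.
Context {Z : completeNormedModType R} (T : X -> dual Z).
Context (T_isometry : surjective_linear_isometry T).

Let Tlin : linear T. Proof. by have [[]] := T_isometry. Qed.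
Let Tnorm x : `|T x| = `|x|. Proof. by have [[]] := T_isometry. Qed.
Let Tsurj phi : exists x, T x = phi.
Proof.
have [_ Trange] := T_isometry.
by have : range T phi; [rewrite Trange|case=> x _; exists x].
Qed.

Lemma slice_linear z : linear (fun x => T x z : R^o).
Proof. by move=> a x y; rewrite Tlin. Qed.

Lemma slice_bounded z x : `|T x z : R^o| <= `|z| * `|x|.
Proof. by rewrite mulrC -Tnorm boundedOp_ub. Qed.

(** The point of the whole construction: the unit vectors are null for the weak*
    topology induced by any predual. *)
Lemma slice_is_predual z :
  bounded_op_of (slice_linear z) (slice_bounded z) \in @is_predual R.
Proof.
rewrite inE; apply: (weak_star_null (M := 1) T_isometry).
  exact: unit_vec_le1.
exact: unit_vec_separated.
Qed.

Definition slice z : Y := Predual (slice_is_predual z).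

Lemma sliceE z (x : X) : slice z x = T x z. Proof. by []. Qed.

Lemma predual_eq (f g : Y) : (forall x : X, f x = g x) -> f = g.
Proof. by move=> fg; apply/val_inj/boundedOp_eq. Qed.

(** The norm of [z] is attained at a functional of norm at most 1 on [Z], and
    every such functional is T x for some [x] in the unit ball of X. *)
Lemma slice_isometry : linear_isometry slice.
Proof.
split=> [a z w|z].
  by apply: predual_eq => x; rewrite sliceE linearP.
apply/eqP; rewrite eq_le; apply/andP; split.
  by apply: predual_norm_le => // x; exact: slice_bounded.
have [phi [phi1 phiz]] := norming_functional z.
have [x Tx] := Tsurj phi.
rewrite -phiz -Tx -sliceE (le_trans (ler_norm _))//.
rewrite (le_trans (predual_ub _ _))// -[leRHS]mulr1 ler_wpM2l//.
by rewrite -Tnorm Tx.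
Qed.

(** Otherwise some [f] has positive distance to the range, which is closed, and
    a nonzero functional on the predual vanishes on the range.  It is the
    evaluation at some [x], and then T x = 0, so x = 0. *)
Lemma slice_surjective f : exists z, slice z = f.
Proof.
apply: contrapT => nf.
have [e e0 fe] : exists2 e, 0 < e & forall z, e <= `|f - slice z|.
  apply: contrapT => H; apply: nf.
  apply: (complete_isometry_closed slice_isometry) => e e0.
  apply: contrapT => H2; apply: H; exists e => // z.
  by rewrite leNgt; apply/negP => /ltW fz; apply: H2; exists z.
have [slin _] := slice_isometry.
have s0 : slice 0 = 0 by apply: predual_eq => x; rewrite sliceE linear0.
have [phi [phi0]] : exists phi : dual Y,
    (forall w, range slice w -> phi w = 0) /\ phi f != 0.
  apply: (separating_functional (d := e)) => //.
  - by move=> a _ _ [z _ <-] [w _ <-]; exists (a *: z + w); rewrite ?slin.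
  - by exists 0.
  - by move=> _ [z _ <-]; exact: fe.
have [x xphi] := duality_surjective phi.
have x0 : x = 0.
  apply: normr0_eq0; rewrite -Tnorm.
  have -> : T x = 0; last by rewrite normr0.
  apply: boundedOp_eq => z; rewrite -sliceE -dualityE xphi.
  by apply: phi0; exists z.
by rewrite -xphi x0 dualityE linear0 eqxx.
Qed.

Lemma predual_isometric : linearly_isometric Y Z.
Proof.
have /choice[g gK] := slice_surjective.
have [slin snorm] := slice_isometry.
have sinj z w : slice z = slice w -> z = w.
  move=> zw; apply/eqP; rewrite -subr_eq0 -normr_eq0.
  by rewrite -(linear_isometryB _ _ slice_isometry) zw subrr normr0.
exists g; split; first split.
- by move=> a f h; apply: sinj; rewrite slin !gK.
- by move=> f; rewrite -snorm gK.
- by apply/seteqP; split=> // z _; exists (slice z) => //; apply: sinj; rewrite gK.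
Qed.

End OtherPredual.

Lemma weak_star_evalC (X' Y' : normedModType R) (J : X' -> dual Y') (y : Y') :
  continuous (fun x : weak_star J => J x y : R^o).
Proof.
pose w (x : X') : {ptws Y' -> R^o} := (J x : Y' -> R^o).
have wC : continuous (w : weak_star J -> {ptws Y' -> R^o}).
  exact: initial_continuous.
have yC : continuous (fun g : {ptws Y' -> R^o} => g y).
  exact: (@proj_continuous Y' (fun=> R^o) y).
by move=> x; exact: (continuous_comp (wC x) (yC (w x))).
Qed.

(** The weak* topology of the target is generated by the evaluations at the
    elements of Z', which pull back to evaluations at elements of Y'. *)
Lemma weak_star_continuous (X' Y' Z' : normedModType R) (J : X' -> dual Y')
    (T : X' -> dual Z') :
  (forall z, exists y, forall x, T x z = J x y) ->
  continuous (T : weak_star J -> weak_star (@idfun (dual Z'))).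
Proof.
move=> TJ; apply: continuous_comp_initial => x.
pose w (x : X') : Z' -> R^o := T x.
suff : {ptws, (w @ nbhs (x : weak_star J)) --> w x} by [].
have wF : Filter (w @ nbhs (x : weak_star J)) by exact: fmap_filter.
apply/pointwise_cvgP => z; have [y Ty] := TJ z.
have JC := @weak_star_evalC _ _ J y.
have E : (fun v => J v y) = (fun v => T v z) by apply/funext => v.
by rewrite E in JC; exact: (JC x).
Qed.

Lemma duality_strongly_unique : strongly_unique_predual (@duality R).
Proof.
split; first exact: duality_surjective_isometry.
  by move=> Z [T TI]; exact: predual_isometric TI.
move=> Z T TI; apply: weak_star_continuous => z.
by exists (slice TI z).
Qed.

End StrongUniqueness.

(** * The isomorphism with ell1 and the hyperplane of sequences with u_0 = 0 *)

Section Hyperplane.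
Context {R : realType}.
Notation X := (renormed R).

Lemma renormed_isomorphic_ell1 : linearly_isomorphic X (ell1 R).
Proof.
have to_lin : linear (fun x : X => x : ell1 R) by [].
have of_lin : linear (fun u : ell1 R => u : X) by [].
have of_le (u : ell1 R) : `|(u : X)| <= 1 * `|u|.
  by rewrite mul1r; exact: renormed_le_ell1.
exists (bounded_op_of to_lin (@ell1_le_renormed R)), (bounded_op_of of_lin of_le).
by split.
Qed.

Definition hyperplane : set X := [set x | coords x 0 = 0].

Lemma hyperplane_submod_closed : submod_closed (mem hyperplane).
Proof.
split=> [|a x y]; rewrite !inE /hyperplane//= coordsD coordsZ => -> ->.
by rewrite mulr0 addr0.
Qed.

Lemma hyperplane_weak_star_closed :
  closed (hyperplane : set (weak_star (@duality R))).
Proof.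
have zC := @weak_star_evalC _ _ _ (@duality R) (coordf 0).
have -> : (hyperplane : set (weak_star (@duality R))) =
    (fun x => duality x (coordf 0)) @^-1` [set 0 : R] by [].
by move/continuous_closedP : zC; apply; exact: closed_eq.
Qed.

Definition hyperplane_projection (x : X) : X := x - coords x 0 *: unit_vec 0.

Lemma coords_projection0 x : coords (hyperplane_projection x) 0 = 0.
Proof. by rewrite coordsD coordsN coordsZ coords_unit_vec mulr1 subrr. Qed.

Lemma coords_projectionS x n :
  coords (hyperplane_projection x) n.+1 = coords x n.+1.
Proof. by rewrite coordsD coordsN coordsZ coords_unit_vec mulr0 subr0. Qed.

Lemma projection_id x : hyperplane x -> hyperplane_projection x = x.
Proof. by move=> x0; rewrite /hyperplane_projection x0 scale0r subr0. Qed.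

Lemma projection_linear : linear hyperplane_projection.
Proof.
move=> a x y; rewrite /hyperplane_projection coordsD coordsZ scalerDl -scalerA.
by rewrite scalerBr opprD addrACA.
Qed.

Lemma projection_le x : `|hyperplane_projection x| <= 1 * `|x|.
Proof.
rewrite mul1r; apply: (renorm_le (u := coords (hyperplane_projection x))) => n.
  under eq_bigr do rewrite coords_projectionS.
  exact: (renorm_sum_ub x).
rewrite coords_projection0 coords_projectionS normr0 add0r.
exact: coord_le.
Qed.

Lemma hyperplane_one_complemented : one_complemented hyperplane.
Proof.
pose P := bounded_op_of projection_linear projection_le.
have PV x : hyperplane (P x) by exact: coords_projection0.
exists P; split.
- by move=> x; exact: projection_id.
- apply/seteqP; split=> [_ [x _ <-]//|x Vx].
  by exists x => //; exact: projection_id.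
(* The norm is at least 1 because the unit vector of index 1 is fixed. *)
apply/eqP; rewrite eq_le opnorm_le_mul//=; last exact: projection_le.
have e1 : 0 < `|unit_vec 1 : X|.
  by apply: lt_le_trans (coord_le (unit_vec 1) 1); rewrite coords_unit_vec normr1.
rewrite -(ler_pM2r e1) mul1r.
have {1}<- : P (unit_vec 1) = unit_vec 1 by exact: projection_id.
exact: boundedOp_ub.
Qed.

Lemma hyperplane_codim1 : has_codim hyperplane 1.
Proof.
exists (fun=> unit_vec 0) => x; exists (\row_(i < 1) coords x 0).
have E (a : 'rV[R]_1) :
    hyperplane (x - \sum_(i < 1) a ord0 i *: unit_vec 0) <-> a ord0 ord0 = coords x 0.
  rewrite big_ord1 /hyperplane/= coordsD coordsN coordsZ coords_unit_vec mulr1.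
  split; first by move=> /eqP; rewrite subr_eq0 => /eqP.
  by move=> ->; rewrite subrr.
split; first by apply/E; rewrite mxE.
by move=> a /E a0; apply/rowP => i; rewrite mxE (ord1 i).
Qed.

Definition shift (u : nat -> R) n : R := if n is k.+1 then u k else 0.

Lemma shift_bounded (u : ell1 R) n :
  \sum_(0 <= i < n) `|shift u i| <= `|u|.
Proof.
case: n => [|n]; first by rewrite big_geq.
by rewrite big_nat_recl//= normr0 add0r ell1_partial_le.
Qed.

Definition hyperplane_embedding (u : ell1 R) : X := ell1_of (shift_bounded u).

Lemma hyperplane_isometric_ell1 : subspace_linearly_isometric (ell1 R) hyperplane.
Proof.
exists hyperplane_embedding; split; first split.
- move=> a u v; apply: ell1_eq => -[|n]; last by [].
  by change (0 = a * 0 + 0 :> R); rewrite mulr0 addr0.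
- move=> u; apply/eqP; rewrite eq_le; apply/andP; split.
    apply: (renorm_le (u := shift u)) => n; first exact: ell1_partial_le.
    rewrite /= normr0 add0r; apply: le_trans (ell1_partial_le u n.+1).
    by rewrite big_nat_recr//= lerDr sumr_ge0.
  by apply: ell1_norm_le => n; exact: (renorm_sum_ub (hyperplane_embedding u)).
apply/seteqP; split=> [_ [u _ <-]//|x x0].
have xM n : \sum_(0 <= i < n) `|coords x i.+1| <= `|x|.
  exact: renorm_sum_ub.
by exists (ell1_of xM) => //; apply: ell1_eq => -[|n] //=.
Qed.

End Hyperplane.

Theorem theoremA1 (R : realType) :
  exists X : completeNormedModType R,
    linearly_isomorphic X (ell1 R) /\
    exists (Y : completeNormedModType R) (J : X -> dual Y),
      strongly_unique_predual J /\
      exists V : set X,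
        [/\ submod_closed (mem V),
            closed (V : set (weak_star J)),
            one_complemented V,
            has_codim V 1%N
          & subspace_linearly_isometric (ell1 R) V].
Proof.
exists (renormed R); split; first exact: renormed_isomorphic_ell1.
exists (predual R), duality; split; first exact: duality_strongly_unique.
exists hyperplane; split.
- exact: hyperplane_submod_closed.
- exact: hyperplane_weak_star_closed.
- exact: hyperplane_one_complemented.
- exact: hyperplane_codim1.
- exact: hyperplane_isometric_ell1.
Qed.
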